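(* Let $A$ be a nonempty finite subset of an abelian group $(G,+)$ and let $h \ge 1$ be an integer. Then $$|(h+1)A| \le |hA|^{\langle h\rangle}.$$
   Context: For an integer $h\ge 1$, $hA=\{x_1+\dots+x_h \mid x_1,\dots,x_h\in A\}$ denotes the $h$-fold iterated sumset of $A$. For positive integers $a$ and $i$, there are unique integers $a_i>a_{i-1}>\dots>a_1\ge 0$ such that $a=\sum_{j=1}^i\binom{a_j}{j}$ (with $\binom{m}{j}=0$ for integers $0\le m<j$); this is called the $i$th binomial representation of $a$. One then defines $a^{\langle i\rangle}=\sum_{j=1}^i\binom{a_j+1}{j+1}$. *)

(* Defs.v *)
From mathcomp Require Import all_boot all_order all_algebra finmap.

Set Implicit Arguments.
Unset Strict Implicit.
Unset Printing Implicit Defensive.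

Import GRing.Theory.

Definition sumset (G : zmodType) (h : nat) (A : {fset G}) : {fset G} :=
  [fset (\sum_(i < h) val (x i))%R | x : {ffun 'I_h -> A} in predT]%fset.

Lemma sumsetP (G : zmodType) (h : nat) (A : {fset G}) (z : G) :
  reflect (exists2 x : 'I_h -> G, (forall i, x i \in A)
                                & z = (\sum_(i < h) x i)%R)
          (z \in sumset h A).
Proof.
apply: (iffP (imfsetP _ _ _ _)) => [[x _ ->]|[x Ax ->]].
  by exists (fun i => val (x i)) => // i; apply: valP.
exists [ffun i => [` Ax i]%fset] => //=.
by apply: eq_bigr => i _; rewrite ffunE.
Qed.

(* The ordinal j : 'I_i stands for the index j + 1, so that c j is the top    *)
(* entry a_(j + 1) of the binomial coefficient with lower entry j + 1.        *)
Definition is_binom_rep (a i : nat) (c : {ffun 'I_i -> nat}) : bool :=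
  [forall j : 'I_i, forall k : 'I_i, (j < k) ==> (c j < c k)]
  && (a == \sum_(j < i) 'C(c j, j.+1)).

Lemma is_binom_repP (a i : nat) (c : {ffun 'I_i -> nat}) :
  reflect ((forall j k : 'I_i, j < k -> c j < c k)
           /\ a = \sum_(j < i) 'C(c j, j.+1))
          (is_binom_rep a c).
Proof.
apply: (iffP andP) => -[Hc Ha]; split; try exact/eqP.
  by move=> j k; apply/implyP; move/forallP/(_ j)/forallP: Hc; apply.
by apply/forallP => j; apply/forallP => k; apply/implyP; apply: Hc.
Qed.

Lemma binom_rep_bounded (i n a : nat) : a < 'C(n, i) ->
  exists c : nat -> nat,
    [/\ forall j k, j < k < i -> c j < c k, forall j, j < i -> c j < n
      & a = \sum_(j < i) 'C(c j, j.+1)].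
Proof.
elim: i n a => [|i IHi] n a Ha.
  exists id; split=> [j k| j|] //; first by rewrite ltn0 andbF.
  by rewrite big_ord0; move: Ha; rewrite bin0; case: a.
have exn : exists m, a < 'C(m, i.+1) by exists n.
case: (ex_minnP exn) => -[|m] // Hm minm.
have le_m : 'C(m, i.+1) <= a.
  by rewrite leqNgt; apply/negP => /minm; rewrite ltnn.
have lt_m : a - 'C(m, i.+1) < 'C(m, i) by rewrite ltn_subLR // -binS.
have [c [cinc cm ca]] := IHi _ _ lt_m.
exists (fun j => if j < i then c j else m); split.
- move=> j k /andP[jk]; rewrite ltnS leq_eqVlt => /predU1P[ki|ki].
    by rewrite ki ltnn -ki jk cm // -ki.
  by rewrite ki (ltn_trans jk ki) cinc // jk.
- move=> j _; have mn := minm _ Ha.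
  by case: ifP => // ji; apply: leq_trans mn; rewrite ltnS ltnW // cm.
- rewrite big_ord_recr /= ltnn.
  by under eq_bigr => j _ do rewrite ltn_ord; rewrite -ca subnK.
Qed.

Lemma binom_rep_lt (i n : nat) (c : nat -> nat) :
    (forall j k, j < k < i -> c j < c k) -> (forall j, j < i -> c j < n) ->
  \sum_(j < i) 'C(c j, j.+1) < 'C(n, i).
Proof.
elim: i n => [|i IHi] n cinc cn; first by rewrite big_ord0 bin0.
rewrite big_ord_recr /=; apply: (@leq_trans 'C((c i).+1, i.+1)).
  rewrite binS addnC ltn_add2l; apply: IHi => [j k /andP[jk ki]|j ji].
    by apply: cinc; rewrite jk ltnW.
  by apply: cinc; rewrite ji /=.
by apply: leq_bin2l; apply: cn.
Qed.

Lemma binom_rep_inj (i : nat) (c d : nat -> nat) :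
    (forall j k, j < k < i -> c j < c k) ->
    (forall j k, j < k < i -> d j < d k) ->
    \sum_(j < i) 'C(c j, j.+1) = \sum_(j < i) 'C(d j, j.+1) ->
  forall j, j < i -> c j = d j.
Proof.
elim: i c d => [//|i IHi] c d cinc dinc eq_cd.
have top (u v : nat -> nat) : (forall j k, j < k < i.+1 -> u j < u k) ->
    \sum_(j < i.+1) 'C(u j, j.+1) = \sum_(j < i.+1) 'C(v j, j.+1) ->
    v i <= u i.
  move=> uinc uv; rewrite leqNgt; apply/negP => uvi.
  have: \sum_(j < i.+1) 'C(u j, j.+1) < 'C((u i).+1, i.+1).
    apply: binom_rep_lt => // j; rewrite !ltnS leq_eqVlt => /predU1P[->//|ji].
    by rewrite ltnW // uinc // ji /=.
  rewrite uv ltnNge big_ord_recr /= => /negP; apply.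
  by apply: leq_trans (leq_addl _ _); apply: leq_bin2l.
have eqi : c i = d i by apply/eqP; rewrite eqn_leq (top d) // (top c).
move=> j; rewrite ltnS leq_eqVlt => /predU1P[->//|ji].
apply: (IHi c d) => // [k l /andP[kl li]|k l /andP[kl li]|].
- by apply: cinc; rewrite kl ltnW.
- by apply: dinc; rewrite kl ltnW.
- by move/eqP: eq_cd; rewrite !big_ord_recr /= eqi eqn_add2r => /eqP.
Qed.

Lemma binom_rep_exists (a i : nat) :
  exists c : {ffun 'I_i.+1 -> nat}, is_binom_rep a c.
Proof.
have Ha : a < 'C(a + i.+1, i.+1).
  elim: a => [|a IHa]; first by rewrite add0n binn.
  rewrite addSn binS; apply: (leq_ltn_trans IHa).
  by rewrite -[X in X < _]addn0 ltn_add2l bin_gt0 addnS ltnW // ltnS leq_addl.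
have [c [cinc _ ca]] := binom_rep_bounded Ha.
exists [ffun j : 'I_i.+1 => c j]; apply/is_binom_repP; split=> [j k jk|].
  by rewrite !ffunE cinc // jk ltn_ord.
by rewrite ca; apply: eq_bigr => j _; rewrite ffunE.
Qed.

Lemma binom_rep_unique (a i : nat) (c d : {ffun 'I_i -> nat}) :
  is_binom_rep a c -> is_binom_rep a d -> c = d.
Proof.
case: i c d => [|i] c d; first by move=> _ _; apply/ffunP => -[].
move=> /is_binom_repP[cinc ca] /is_binom_repP[dinc da].
have inc (u : {ffun 'I_i.+1 -> nat}) :
    (forall j k : 'I_i.+1, j < k -> u j < u k) ->
    forall j k, j < k < i.+1 -> u (inord j) < u (inord k).
  by move=> uinc j k /andP[jk ki]; apply: uinc; rewrite !inordK // (ltn_trans jk).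
have sumE (u : {ffun 'I_i.+1 -> nat}) :
    \sum_(j < i.+1) 'C(u (inord j), j.+1) = \sum_(j < i.+1) 'C(u j, j.+1).
  by apply: eq_bigr => j _; rewrite inord_val.
apply/ffunP => j; rewrite -[j]inord_val.
apply: (binom_rep_inj (inc c cinc) (inc d dinc)) (ltn_ord j).
by rewrite !sumE -ca -da.
Qed.

(* For i = 0, where only a = 0 has a representation, the value is the empty   *)
(* function.                                                                  *)
Definition binom_rep (a i : nat) : {ffun 'I_i -> nat} :=
  match i return {ffun 'I_i -> nat} with
  | 0 => [ffun=> 0]
  | i'.+1 => xchoose (binom_rep_exists a i')
  end.

Lemma binom_repP (a i : nat) : 0 < i -> is_binom_rep a (binom_rep a i).
Proof. by case: i => // i _; apply: xchooseP. Qed.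

(* a^<i>, the sum of the C(a_j + 1, j + 1) for 1 <= j <= i                    *)
Definition binom_upper (a i : nat) : nat :=
  \sum_(j < i) 'C((binom_rep a i j).+1, j.+2).

(* Main.v *)
Require Import Defs.
From mathcomp Require Import all_boot all_order all_algebra finmap.
From mathcomp Require Import zify.

(* Write the elements of hA as values of monomials of degree h in variables indexed
   by A, and choose in each fibre the monomial of least weight, for a positional
   weight that is additive and injective.  A divisor of a least monomial is least, so
   the chosen monomials of degree h contain all degree h divisors of those of degree
   h + 1, and Macaulay's bound applies.

   For Macaulay's bound, compressing two variables at a time makes the family T of
   monomials of degree d + 1 stable under replacing any variable by a fixed one p.
   Let t_k be the size of the slice of exponent k in p.  Stability puts the shadow of
   slice k, with p removed, inside slice k + 1; hence, by induction on the number of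
   variables, a large t_0 forces all t_k to be large, and through Pascal's rule more
   than |S| monomials of T are divisible by p.  Division by p embeds these in S, so t_0
   is small, and |T| <= t_0 + |S| is the bound. *)

Set Implicit Arguments.
Unset Strict Implicit.
Unset Printing Implicit Defensive.

Import GRing.Theory.

Local Open Scope fset_scope.
Local Open Scope nat_scope.

(** * Counting in intervals and sums of binomial coefficients *)

(** If [P] misses some b <= e, sending a < b to a and a > b to a - 1 injects [P] into [Q]; if it
    misses none, [Q] fills all [e] places. *)
Lemma sum_shadow_interval (P Q : pred nat) (e : nat) :
    (forall a, a < e -> P a -> Q a) -> (forall a, a < e -> P a.+1 -> Q a) ->
  minn (\sum_(a < e.+1) P a) e <= \sum_(a < e) Q a.
Proof.
move=> PQ PSQ.
have alt : (\sum_(a < e.+1) P a <= \sum_(a < e) Q a)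
    \/ (forall a, a <= e -> P a).
  elim: e PQ PSQ => [|e IHe] PQ PSQ.
    rewrite big_ord_recl !big_ord0 /=; case P0: (P 0); [right|by left].
    by case.
  case: IHe => [a /ltnW|a /ltnW|le_PQ|allP]; [exact: PQ|exact: PSQ| |].
    left; rewrite big_ord_recr [X in _ <= X]big_ord_recr /= leq_add //.
    by case: (P e.+1) (PSQ e (ltnSn _)) => // ->.
  case Pe: (P e.+1); [right=> a|left].
    by rewrite leq_eqVlt => /predU1P[->//|]; apply: allP.
  rewrite big_ord_recr /= Pe addn0; apply: leq_sum => a _.
  by case: (P a) (PQ a (ltn_ord a)) => // ->.
case: alt => [|allP]; first by apply: leq_trans (geq_minl _ _).
apply: leq_trans (geq_minr _ _) _.
rewrite (eq_bigr (fun=> 1)) ?sum1_card ?card_ord // => a _.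
by rewrite PQ // allP // ltnW.
Qed.

(** Pushing a set of exponents to the initial segment of the same size lowers their sum unless
    nothing moves; this drives the descent to a stable family. *)
Lemma sum_initial_segment (P : pred nat) (n t : nat) :
    \sum_(a < n) P a = t ->
  \sum_(a < n) (a < t) * a <= \sum_(a < n) P a * a
  /\ (\sum_(a < n) (a < t) * a = \sum_(a < n) P a * a ->
      forall a, a < n -> P a -> a < t).
Proof.
elim: n t => [|n IHn] t; first by rewrite !big_ord0.
have segE k m : m <= k -> \sum_(a < k) (a < m) * a = \sum_(a < m) a.
  elim: k => [|k IHk]; first by rewrite leqn0 => /eqP->; rewrite !big_ord0.
  rewrite leq_eqVlt => /predU1P[->|mk].
    by apply: eq_bigr => a _; rewrite ltn_ord mul1n.
  by rewrite big_ord_recr /= IHk // ltnNge -ltnS mk addn0.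
have le_tn k : \sum_(a < k) P a <= k.
  by rewrite -[k in _ <= k]card_ord -sum1_card leq_sum // => a _; case: (P a).
move=> tE; have le_tn1 : t <= n.+1 by rewrite -tE.
move: (le_tn n) (IHn _ (erefl _)) tE.
rewrite !segE // [\sum_(a < n.+1) P a]big_ord_recr [\sum_(a < n.+1) P a * a]big_ord_recr /=.
set u := \sum_(a < n) P a; set w := \sum_(a < n) P a * a => le_un [le_w eq_w].
case Pn: (P n); rewrite ?mul1n ?mul0n ?addn1 ?addn0 => <-.
  rewrite big_ord_recr /=; split; first exact: leq_add.
  (* Since [u <= n], equality of the sums forces both [u = n] and equality below [n]. *)
  move=> eqw a; rewrite ltnS leq_eqVlt => /predU1P[-> _|an Pa].
    by rewrite ltnS; lia.
  by rewrite ltnS ltnW // eq_w //; lia.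
split=> // /eq_w ltu a; rewrite ltnS leq_eqVlt => /predU1P[->|]; last exact: ltu.
by rewrite Pn.
Qed.

(** The hypothesis for the sequence c - 1 bounds [t 1] from below; the terms j > 0 of that bound
    feed the induction on shifted sequences, and Pascal's rule adds the two results. *)
Lemma sum_binomial_slices (d : nat) (c t : nat -> nat) :
    (forall k (c' : nat -> nat), k <= d ->
       \sum_(j < d - k) 'C((c' j).+1, j.+2) < t k ->
       \sum_(j < d - k) 'C(c' j, j.+1) < t k.+1) ->
    \sum_(j < d) 'C(c j, j.+2) < t 0 ->
  \sum_(j < d) 'C(c j, j.+1) < \sum_(k < d.+1) t k.+1.
Proof.
elim: d c t => [|d IHd] c t step.
  rewrite big_ord1 => t0; move: t0 (step 0 c isT).
  by rewrite !big_ord0 => t0; apply.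
move=> t0.
have t1 : \sum_(j < d.+1) 'C((c j).-1, j.+1) < t 1.
  apply: (step 0 (fun j => (c j).-1)) => //; rewrite subn0.
  rewrite (eq_bigr (fun j : 'I_d.+1 => 'C(c j, j.+2))) // => j _.
  by case: (c j).
have IH : \sum_(j < d) 'C((c j.+1).-1, j.+1) < \sum_(k < d.+1) t k.+2.
  apply: (IHd (fun j => (c j.+1).-1) (fun k => t k.+1)).
    by move=> k c' lekd; apply: (step k.+1).
  apply: leq_ltn_trans t1; rewrite big_ord_recl /= -[X in X <= _]add0n leq_add //.
apply: (@leq_ltn_trans (\sum_(j < d.+1) ('C((c j).-1, j.+1) + 'C((c j).-1, j)))).
  by apply: leq_sum => j _; case: (c j) => [|x] //=; rewrite binS.
(* The term j = 0 of the second sum is 1, paid for by having two strict inequalities. *)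
rewrite big_split /= [X in _ + X]big_ord_recl bin0 add1n addnS -addSn.
by rewrite [X in _ < X]big_ord_recl -addnS; apply: leq_add.
Qed.

(** * Monomials and their shadows *)

Section Monomials.

Variable I : finType.
Implicit Types (m u : {ffun I -> nat}) (S T : {fset {ffun I -> nat}}).

Definition mdeg m : nat := \sum_i m i.

(** Division by the variable [i]; truncated subtraction fixes the monomials that [i] does not
    divide. *)
Definition mdivx i m : {ffun I -> nat} := [ffun j => m j - (j == i)].

Definition covers_shadow S T : Prop :=
  forall m i, m \in T -> 0 < m i -> mdivx i m \in S.

Lemma mdeg_mdivx i m : 0 < m i -> mdeg m = (mdeg (mdivx i m)).+1.
Proof.
move=> mi; rewrite /mdeg (bigD1 i) //= [in RHS](bigD1 i) //= ffunE eqxx subn1 -addSn prednK //.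
by congr (_ + _); apply: eq_bigr => j /negbTE ji; rewrite ffunE ji subn0.
Qed.

(** * Compression of one variable towards another *)

Section Compression.

Variables p q : I.
Hypothesis p_neq_q : p != q.

Let qp : (q == p) = false. Proof. by rewrite eq_sym (negbTE p_neq_q). Qed.
Let pq : (p == q) = false. Proof. exact: negbTE. Qed.

(* Monomials with the same collapse to p form a chain indexed by the exponent a of q,
   expand u a being the a-th one; compress T pushes each fibre of T to its start. *)
Definition collapse m : {ffun I -> nat} :=
  [ffun i => if i == p then m p + m q else if i == q then 0 else m i].

Definition expand u (a : nat) : {ffun I -> nat} :=
  [ffun i => if i == p then u p - a else if i == q then a else u i].

Lemma collapse_p m : collapse m p = m p + m q. Proof. by rewrite ffunE eqxx. Qed.
Lemma collapse_q m : collapse m q = 0. Proof. by rewrite ffunE qp eqxx. Qed.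
Lemma expand_p u a : expand u a p = u p - a. Proof. by rewrite ffunE eqxx. Qed.
Lemma expand_q u a : expand u a q = a. Proof. by rewrite ffunE qp eqxx. Qed.

Lemma collapseK m : expand (collapse m) (m q) = m.
Proof.
apply/ffunP => i; rewrite !ffunE eqxx.
by case: eqP => [->|_]; [rewrite addnK | case: eqP => [->|]].
Qed.

Lemma expandK u a : u q = 0 -> a <= u p -> collapse (expand u a) = u.
Proof.
move=> uq au; apply/ffunP => i; rewrite !ffunE qp !eqxx.
by case: eqP => [->|_]; [rewrite subnK | case: eqP => [->|]].
Qed.

Lemma mdeg_collapse m : mdeg (collapse m) = mdeg m.
Proof.
rewrite /mdeg (bigD1 p) // (bigD1 q) ?qp //= [RHS](bigD1 p) // [in RHS](bigD1 q) ?qp //=.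
rewrite collapse_p collapse_q add0n addnA.
congr (_ + _); apply: eq_bigr => i /andP[/negbTE ip /negbTE iq].
by rewrite ffunE ip iq.
Qed.

Definition fibre_count T u : nat := \sum_(a < (u p).+1) (expand u a \in T).

(** A monomial is determined by its collapse and its exponent of q. [K] is left free so that [T] and
    [compress T] can be summed over the same keys. *)
Lemma sum_fibres T (K : {fset {ffun I -> nat}}) (F : {ffun I -> nat} -> nat) :
    (forall m, m \in T -> collapse m \in K) -> (forall u, u \in K -> u q = 0) ->
  \sum_(m <- T) F m
    = \sum_(u <- K) \sum_(a < (u p).+1) (expand u a \in T) * F (expand u a).
Proof.
move=> TK Kq.
have -> : \sum_(m <- T) F m = \sum_(u <- K) \sum_(m <- T | collapse m == u) F m.
  rewrite (exchange_big_dep predT) //= !big_seq; apply: eq_bigr => m mT.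
  rewrite (eq_bigl (pred1 (collapse m))) => [|u]; last by rewrite /= eq_sym.
  by rewrite -big_filter filter_pred1_uniq ?fset_uniq ?TK // big_seq1.
rewrite !big_seq; apply: eq_bigr => u uK.
rewrite -(big_mkord xpredT (fun a => (expand u a \in T) * F (expand u a))).
rewrite (eq_bigr (fun a => if expand u a \in T then F (expand u a) else 0));
  last by move=> a _; case: ifP; rewrite ?mul1n.
rewrite -big_mkcond /= -[LHS]big_filter -[RHS]big_filter -[RHS](big_map (expand u) xpredT F).
apply: perm_big; apply: uniq_perm.
- by rewrite filter_uniq ?fset_uniq.
- rewrite map_inj_uniq ?filter_uniq ?iota_uniq // => a b /(congr1 (fun m => m q)).
  by rewrite !expand_q.
- move=> m; rewrite mem_filter; apply/andP/mapP => [[/eqP mu mT]|[a]].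
    exists (m q); last by rewrite -mu collapseK.
    by rewrite mem_filter -mu collapseK mT mem_index_iota collapse_p ltnS leq_addl.
  rewrite mem_filter mem_index_iota ltnS => /andP[aT /= au] ->.
  by rewrite expandK ?Kq.
Qed.

Definition keys T : {fset {ffun I -> nat}} := [fset collapse m | m in T].

Definition compress T : {fset {ffun I -> nat}} :=
  [fset expand u a | u in keys T, a in iota 0 (fibre_count T u)].

Lemma fibre_count_le T u : fibre_count T u <= (u p).+1.
Proof.
by rewrite -[X in _ <= X]card_ord -sum1_card leq_sum // => a _; case: (_ \in _).
Qed.

Lemma keys_q T u : u \in keys T -> u q = 0.
Proof. by case/imfsetP => m _ ->; rewrite collapse_q. Qed.

Lemma fibre_count_gt0 T u : u q = 0 -> 0 < fibre_count T u -> u \in keys T.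
Proof.
move=> uq; rewrite lt0n sum_nat_eq0 negb_forall => /existsP[a].
rewrite eqb0 negbK => aT; apply/imfsetP; exists (expand u a) => //.
by rewrite expandK // -ltnS.
Qed.

Lemma mem_compress T m : (m \in compress T) = (m q < fibre_count T (collapse m)).
Proof.
apply/imfset2P/idP => [[u uT [a]]|mT].
  rewrite mem_iota add0n => /= aT ->; rewrite expand_q expandK ?(keys_q uT) //.
  by rewrite -ltnS (leq_trans aT) // fibre_count_le.
exists (collapse m); first by apply: fibre_count_gt0 (leq_ltn_trans _ mT); rewrite ?collapse_q.
by exists (m q); rewrite ?mem_iota ?collapseK.
Qed.

Lemma expand_compress T u a : u q = 0 -> a <= u p ->
  (expand u a \in compress T) = (a < fibre_count T u).
Proof. by move=> uq au; rewrite mem_compress expand_q expandK. Qed.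

Lemma keys_compress T m : m \in compress T -> collapse m \in keys T.
Proof.
rewrite mem_compress => mT; apply: fibre_count_gt0 (leq_ltn_trans _ mT) => //.
exact: collapse_q.
Qed.

Lemma mem_keys T m : m \in T -> collapse m \in keys T.
Proof. by move=> mT; apply/imfsetP; exists m. Qed.

Lemma sum_compress T (F : {ffun I -> nat} -> nat) :
  \sum_(m <- compress T) F m = \sum_(u <- keys T)
     \sum_(a < (u p).+1) (a < fibre_count T u) * F (expand u a).
Proof.
rewrite (sum_fibres _ (@keys_compress T) (@keys_q T)) !big_seq.
apply: eq_bigr => u /keys_q uq; apply: eq_bigr => a _.
by rewrite expand_compress // -ltnS.
Qed.

(** The summand depends on the key alone, and compression preserves the size of each fibre. *)
Lemma sum_collapse_compress T (H : {ffun I -> nat} -> nat) :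
  \sum_(m <- compress T) H (collapse m) = \sum_(m <- T) H (collapse m).
Proof.
rewrite sum_compress (sum_fibres _ (@mem_keys T) (@keys_q T)) !big_seq.
apply: eq_bigr => u /keys_q uq.
rewrite (eq_bigr (fun a : 'I_(u p).+1 => (a < fibre_count T u) * H u)); last first.
  by move=> a _; rewrite expandK // -ltnS.
rewrite [RHS](eq_bigr (fun a : 'I_(u p).+1 => (expand u a \in T) * H u)); last first.
  by move=> a _; rewrite expandK // -ltnS.
rewrite -!big_distrl -/(fibre_count T u) /=; congr (_ * _).
have := fibre_count_le T u.
elim: (u p).+1 (fibre_count T u) => [|n IHn] t; first by rewrite leqn0 big_ord0 => /eqP.
rewrite big_ord_recr /= leq_eqVlt => /predU1P[->|].
  under eq_bigr => a _ do rewrite leqW //.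
  by rewrite sum1_card card_ord ltnSn addn1.
by rewrite ltnS => tn; rewrite IHn // ltnNge tn addn0.
Qed.

Lemma card_compress T : #|` compress T| = #|` T|.
Proof. by rewrite !card_fset_sum1 (sum_collapse_compress T (fun=> 1)). Qed.

(** Fibre by fibre this is [sum_initial_segment]; equal totals force equality in every fibre, so
    each is already initial. *)
Lemma sum_q_compress T : \sum_(m <- compress T) m q <= \sum_(m <- T) m q
  /\ (\sum_(m <- compress T) m q = \sum_(m <- T) m q -> T `<=` compress T).
Proof.
pose P u a := expand u a \in T.
pose f u := \sum_(a < (u p).+1) (a < fibre_count T u) * a.
pose g u := \sum_(a < (u p).+1) P u a * a.
have fE : \sum_(m <- compress T) m q = \sum_(u <- keys T) f u.
  rewrite sum_compress; apply: eq_bigr => u _; apply: eq_bigr => a _.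
  by rewrite expand_q.
have gE : \sum_(m <- T) m q = \sum_(u <- keys T) g u.
  rewrite (sum_fibres _ (@mem_keys T) (@keys_q T)).
  by apply: eq_bigr => u _; apply: eq_bigr => a _; rewrite expand_q.
have fg u : f u <= g u by case: (@sum_initial_segment (P u) (u p).+1 _ erefl).
rewrite fE gE; split=> [|eq_fg]; first exact: leq_sum.
apply/fsubsetP => m mT; have uT := mem_keys mT.
have eq_u : f (collapse m) = g (collapse m).
  apply/eqP; rewrite eqn_leq fg /= -(leq_add2r (\sum_(u <- keys T `\ collapse m) f u)).
  rewrite -(big_fsetD1 _ uT) /= eq_fg (big_fsetD1 _ uT) /= leq_add2l.
  exact: leq_sum.
have [_ /(_ eq_u) lt_P] := @sum_initial_segment (P (collapse m)) (collapse m p).+1 _ erefl.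
by rewrite mem_compress lt_P ?collapse_p ?ltnS ?leq_addl // /P collapseK.
Qed.

(** Division by a third variable carries the fibre over [u] into that over [mdivx i u], keeping the
    exponent of q. *)
Lemma fibre_count_mdivx S T u i :
    covers_shadow S T -> i != p -> i != q -> 0 < u i ->
  fibre_count T u <= fibre_count S (mdivx i u).
Proof.
move=> ST ip iq ui; rewrite /fibre_count [mdivx i u p]ffunE.
rewrite (eq_sym p i) (negbTE ip) subn0.
apply: leq_sum => a _; case aT: (expand u a \in T) => //.
have -> // : expand (mdivx i u) a \in S.
have := ST _ i aT; rewrite ffunE (negbTE ip) (negbTE iq) => /(_ ui).
congr (_ \in S); apply/ffunP => j; rewrite !ffunE (eq_sym p i) (negbTE ip).
case: eqP => [->|_]; first by rewrite (eq_sym p i) (negbTE ip) !subn0.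
by case: eqP => [->|//]; rewrite (eq_sym q i) (negbTE iq) subn0.
Qed.

(* The minimum accounts for a full fibre of u p + 1 monomials, whose divisors fill only u p places. *)
Lemma fibre_count_mdivx_p S T u : covers_shadow S T -> u q = 0 ->
  minn (fibre_count T u) (u p) <= fibre_count S (mdivx p u).
Proof.
move=> ST uq; case: (posnP (u p)) => [->|up]; first by rewrite minn0.
rewrite {2}/fibre_count [mdivx p u p]ffunE eqxx subn1 prednK //.
apply: (@sum_shadow_interval (fun a => expand u a \in T)
          (fun a => expand (mdivx p u) a \in S)) => a au /ST.
  move=> /(_ p); rewrite expand_p subn_gt0 => /(_ au); congr (_ \in S).
  apply/ffunP => j; rewrite !ffunE eqxx.
  by case: eqP => _; [rewrite subnAC | case: eqP; rewrite subn0].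
move=> /(_ q); rewrite expand_q => /(_ isT); congr (_ \in S).
apply/ffunP => j; rewrite !ffunE eqxx.
case: eqP => [->|_]; first by rewrite pq subn0 -subnDA.
by case: eqP => _; rewrite ?subn0 ?subn1.
Qed.

(** Division by p keeps the place [m q] in the chain and division by q lowers it by one; both reach
    the chain of [mdivx p (collapse m)], where [fibre_count_mdivx_p] leaves enough room. *)
Lemma covers_shadow_compress S T :
  covers_shadow S T -> covers_shadow (compress S) (compress T).
Proof.
move=> ST m i; rewrite !mem_compress => mT mi.
have Sp := fibre_count_mdivx_p ST (collapse_q m).
case: (eqVneq i p) mi => [->|ip] mi.
  have -> : collapse (mdivx p m) = mdivx p (collapse m).
    apply/ffunP => j; rewrite !ffunE eqxx qp.
    by case: eqP => _; [lia | case: eqP; rewrite subn0].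
  apply: leq_trans Sp; rewrite ffunE qp subn0 leq_min mT collapse_p; lia.
case: (eqVneq i q) mi => [->|iq] mi.
  have -> : collapse (mdivx q m) = mdivx p (collapse m).
    apply/ffunP => j; rewrite !ffunE eqxx pq.
    case: eqP => _; first by lia.
    by case: eqP => _; rewrite !subn0.
  apply: leq_trans Sp; rewrite ffunE eqxx leq_min collapse_p; lia.
have -> : collapse (mdivx i m) = mdivx i (collapse m).
  apply/ffunP => j; rewrite !ffunE (eq_sym p i) (eq_sym q i) (negbTE ip) (negbTE iq).
  case: eqP => [->|_]; first by rewrite (eq_sym p i) (negbTE ip) !subn0.
  by case: eqP => [->|//]; rewrite (eq_sym q i) (negbTE iq).
have -> : mdivx i m q = m q by rewrite ffunE (eq_sym q i) (negbTE iq) subn0.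
apply: leq_trans mT _; apply: fibre_count_mdivx => //.
by rewrite ffunE (negbTE ip) (negbTE iq).
Qed.

End Compression.

(** * Families stable under exchange of variables *)

(** The monomial m x_p / x_q, meant for q dividing m. *)
Definition mexchange p q m : {ffun I -> nat} :=
  [ffun i => mdivx q m i + (i == p)].

(** The support set [J] lets the number of variables shrink while the index type stays fixed. *)
Definition homogeneous (J : {set I}) (n : nat) T : Prop :=
  forall m, m \in T -> mdeg m = n /\ forall i, i \notin J -> m i = 0.

Lemma homogeneous_compress p q (J : {set I}) n T : p != q -> p \in J -> q \in J ->
  homogeneous J n T -> homogeneous J n (compress p q T).
Proof.
move=> pq pJ qJ hT m /(keys_compress pq)/imfsetP[m' /= /hT[degm' suppm'] eq_mm'].
rewrite -(mdeg_collapse pq) eq_mm' mdeg_collapse //; split=> // i iJ.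
have ip : i == p = false by apply: contraNF iJ => /eqP->.
have iq : i == q = false by apply: contraNF iJ => /eqP->.
by have := congr1 (fun m => m i) eq_mm'; rewrite !ffunE ip iq suppm'.
Qed.

(** Equal sizes turn the inclusion into equality; the exchange keeps the collapse and lowers the
    exponent of q, so it stays in the initial segment. *)
Lemma mexchange_mem p q T m : p != q -> T `<=` compress p q T ->
  m \in T -> 0 < m q -> mexchange p q m \in T.
Proof.
move=> pq sub mT mq.
have -> : T = compress p q T by apply/eqP; rewrite eqEfcard sub card_compress //=.
have := fsubsetP sub m mT; rewrite !mem_compress // => lt_m.
have -> : collapse p q (mexchange p q m) = collapse p q m.
  apply/ffunP => i; rewrite !ffunE !eqxx (negbTE pq) (eq_sym q p) (negbTE pq).
  case: eqP => [_|/eqP/negbTE ip]; first by lia.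
  by case: eqP => // /eqP/negbTE iq; rewrite subn0 addn0.
apply: leq_ltn_trans lt_m; rewrite !ffunE (eq_sym q p) (negbTE pq) addn0.
exact: leq_subr.
Qed.

(** Compressions towards p keep sizes, homogeneity and shadow covering, so they are repeated until
    none moves [T]; [S] just undergoes the same ones. *)
Lemma exists_stable p (J : {set I}) n S T :
    p \in J -> homogeneous J n T -> covers_shadow S T ->
  exists S' T', [/\ #|` S'| = #|` S|, #|` T'| = #|` T|, homogeneous J n T',
    covers_shadow S' T'
    & forall m q, m \in T' -> q != p -> 0 < m q -> mexchange p q m \in T'].
Proof.
move=> pJ.
(* Each compression that changes T lowers the total exponent outside p. *)
have [N] := ubnP (\sum_(m <- T) \sum_(i | i != p) m i).
elim: N S T => // N IHN S T leN hT ST.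
case: (boolP [forall q in J, (q != p) ==> (T `<=` compress p q T)]).
  move=> /forall_inP stable; exists S, T; split=> // m q mT qp mq.
  apply: mexchange_mem; rewrite 1?eq_sym //.
  apply: implyP (stable q _) qp; apply: contraLR mq => qJ.
  by rewrite -leqNgt (hT m mT).2.
rewrite negb_forall_in => /exists_inP[q qJ]; rewrite negb_imply eq_sym => /andP[pq nsub].
have [le_q eq_q] := sum_q_compress pq T.
have lt_q : \sum_(m <- compress p q T) m q < \sum_(m <- T) m q.
  by rewrite ltn_neqAle le_q andbT; apply: contra nsub => /eqP/eq_q.
(* The second term depends on the collapse only, so compression leaves its total unchanged. *)
have restE m : \sum_(i | i != p) m i
    = m q + \sum_(i | (i != p) && (i != q)) collapse p q m i.
  rewrite (bigD1 q) 1?eq_sym //=; congr (_ + _).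
  by apply: eq_bigr => i /andP[/negbTE ip /negbTE iq]; rewrite ffunE ip iq.
have := @IHN (compress p q S) (compress p q T).
case=> [|||S' [T' [cS cT hT' ST' stable]]].
- rewrite ltnS in leN; apply: leq_trans leN; under eq_bigr do rewrite restE.
  under [X in _ < X]eq_bigr do rewrite restE.
  pose rest u := \sum_(i | (i != p) && (i != q)) u i.
  rewrite !big_split /= -/rest; have := sum_collapse_compress pq T rest.
  by rewrite /rest => ->; rewrite ltn_add2r.
- exact: homogeneous_compress.
- exact: covers_shadow_compress.
by exists S', T'; rewrite cS cT !card_compress.
Qed.

End Monomials.

(** * Slices and Macaulay's bound *)

Section Macaulay.

Variable I : finType.
Implicit Types (m : {ffun I -> nat}) (S T : {fset {ffun I -> nat}}).

Definition mzero p m : {ffun I -> nat} := [ffun i => if i == p then 0 else m i].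

Definition mslice p k T : {fset {ffun I -> nat}} :=
  [fset mzero p m | m in [fset m in T | m p == k]].

Lemma mslicePn p k T m : reflect
  (exists2 m', m' \in T /\ m' p = k
     & m = mzero p m') (m \in mslice p k T).
Proof.
apply: (iffP (imfsetP _ _ _ _)) => [[m' /=]|[m' [m'T m'p] ->]].
  by rewrite !inE /= => /andP[m'T /eqP m'p] ->; exists m'.
by exists m' => //=; rewrite !inE /= m'T m'p eqxx.
Qed.

Lemma card_fset_cond T (P : pred {ffun I -> nat}) :
  #|` [fset m in T | P m]| = \sum_(m <- T) P m.
Proof. by rewrite card_fset_sum1 big_fset big_mkcond; apply: eq_bigr => m _; case: (P m). Qed.

Lemma card_mslice p k T : #|` mslice p k T| = \sum_(m <- T) (m p == k).
Proof.
rewrite -(card_fset_cond T (fun m => m p == k)) card_in_imfset //= => m1 m2.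
rewrite !inE /= => /andP[_ /eqP m1p] /andP[_ /eqP m2p] /ffunP eq12.
apply/ffunP => i; have := eq12 i; rewrite !ffunE.
by case: eqP => // ->; rewrite m1p m2p.
Qed.

Lemma homogeneous_mslice (J : {set I}) n p k T :
  homogeneous J n T -> homogeneous (J :\ p) (n - k) (mslice p k T).
Proof.
move=> hT _ /mslicePn[m [/hT[<- suppm] <-] ->]; split=> [|i].
  rewrite /mdeg [in RHS](bigD1 p) //= addKn (bigD1 p) //= ffunE eqxx add0n.
  by apply: eq_bigr => i /negbTE ip; rewrite ffunE ip.
by rewrite !inE ffunE; case: eqP => //= _ /suppm.
Qed.

(** If [m] has exponent [k] in p, then m x_p / x_q has exponent [k.+1], and erasing p from it gives
    the same monomial as erasing p from m / x_q. *)
Lemma covers_shadow_mslice p k T :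
    (forall m q, m \in T -> q != p -> 0 < m q -> mexchange p q m \in T) ->
  covers_shadow (mslice p k.+1 T) (mslice p k T).
Proof.
move=> stable _ q /mslicePn[m [mT mp] ->]; rewrite ffunE; case: eqP => // /eqP qp mq.
apply/mslicePn; exists (mexchange p q m).
  by split; [exact: stable | rewrite !ffunE eqxx mp eq_sym (negbTE qp) subn0 addn1].
apply/ffunP => i; rewrite !ffunE; case: eqP => // _; exact/esym/addn0.
Qed.

Lemma card_covers_shadow p S T :
  covers_shadow S T -> \sum_(m <- T) (0 < m p) <= #|` S|.
Proof.
move=> ST; rewrite -(card_fset_cond T (fun m => 0 < m p)).
have <- : #|` [fset mdivx p m | m in [fset m in T | 0 < m p]]|
    = #|` [fset m in T | 0 < m p]|.
  rewrite card_in_imfset //=.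
  move=> m1 m2; rewrite !inE /= => /andP[_ m1p] /andP[_ m2p] /ffunP eq12.
  apply/ffunP => i; have := eq12 i; rewrite !ffunE.
  by case: eqP => [->|_]; [lia | rewrite !subn0].
apply/fsubset_leq_card/fsubsetP => _ /imfsetP[m /= + ->].
by rewrite !inE /= => /andP[mT mp]; apply: ST.
Qed.

(* The c j need not increase, which is what lets the induction on slices shift them freely. *)
Theorem macaulay_growth (J : {set I}) (d : nat) (c : nat -> nat) S T :
    homogeneous J d.+1 T -> covers_shadow S T ->
    #|` S| <= \sum_(j < d) 'C(c j, j.+1) ->
  #|` T| <= \sum_(j < d) 'C((c j).+1, j.+2).
Proof.
have [n] := ubnP #|J|; elim: n J d c S T => // n IHn J d c S T leJ hT ST leS.
have [J0|[p pJ]] := set_0Vmem J.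
  (* Without variables a monomial has degree 0, not [d.+1]. *)
  suff -> : T = fset0 by rewrite cardfs0.
  apply/eqP; rewrite -[_ == _]negbK; apply/fset0Pn => -[m /hT[+ suppm]].
  by rewrite /mdeg big1 // => i _; rewrite suppm // J0 inE.
have [S' [T' [cS cT]]] := exists_stable pJ hT ST.
move: cS cT leS => <- <- leS {S T hT ST}; move: S' T' leS => S T leS hT ST stable.
pose t (k : nat) := #|` mslice p k T|.
(* Contrapositive of the induction hypothesis for slices [k] and [k.+1], which lack the variable p;
   slice [k] has degree [(d - k).+1]. *)
have step k (c' : nat -> nat) : k <= d -> \sum_(j < d - k) 'C((c' j).+1, j.+2) < t k ->
    \sum_(j < d - k) 'C(c' j, j.+1) < t k.+1.
  move=> kd; rewrite !ltnNge; apply: contra => le_tk.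
  have cov := covers_shadow_mslice (k := k) stable.
  apply: (IHn (J :\ p) (d - k) c' _ _ _ _ cov le_tk).
    by move: leJ; rewrite (cardsD1 p) pJ ltnS.
  by rewrite -subSn //; apply: homogeneous_mslice.
(* A multiple of p is counted by at most one [t k.+1], that of its exponent in p; a monomial without
   p by none. *)
have tS : \sum_(k < d.+1) t k.+1 <= #|` S|.
  apply: leq_trans (card_covers_shadow p ST).
  rewrite (eq_bigr (fun k : 'I_d.+1 => \sum_(m <- T) (m p == k.+1))); last first.
    by move=> k _; apply: card_mslice.
  rewrite exchange_big /= leq_sum // => m _.
  case: (m p) => [|a]; first by rewrite big1.
  have [ad|da] := ltnP a d.+1; last first.
    rewrite big1 // => k _; rewrite eqSS; case: eqP => // ak.
    by move: (ltn_ord k); rewrite -ak ltnNge da.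
  rewrite (bigD1 (Ordinal ad)) //= eqxx big1 // => k; rewrite eqSS.
  by rewrite -val_eqE /= eq_sym => /negbTE->.
have t0 : t 0 <= \sum_(j < d) 'C(c j, j.+2).
  rewrite leqNgt; apply/negP => /(sum_binomial_slices step).
  by rewrite ltnNge (leq_trans tS).
have -> : #|` T| = t 0 + \sum_(m <- T) (0 < m p).
  rewrite /t card_mslice card_fset_sum1 -big_split; apply: eq_bigr => m _ /=.
  by case: (m p).
(* Pascal's rule splits the bound into that of [t 0] and that of [S]. *)
under [X in _ <= X]eq_bigr do rewrite binS.
rewrite big_split /= leq_add //; exact: leq_trans (card_covers_shadow p ST) leS.
Qed.

End Macaulay.

(** * Least monomials representing the iterated sumsets *)

(** Uniqueness of digits in base [B]: the remainder modulo [B] gives digit 0, the quotient the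
    others. *)
Lemma positional_inj (B n : nat) (x y : 'I_n -> nat) :
    (forall i, x i < B) -> (forall i, y i < B) ->
  \sum_i x i * B ^ i = \sum_i y i * B ^ i -> x =1 y.
Proof.
elim: n x y => [x y _ _ _ []//|n IHn] x y xB yB.
have shiftE (z : 'I_n.+1 -> nat) : \sum_i z i * B ^ i
    = (\sum_(i < n) z (lift ord0 i) * B ^ i) * B + z ord0.
  rewrite big_ord_recl muln1 addnC; congr (_ + _); rewrite big_distrl /=.
  by apply: eq_bigr => i _; rewrite /bump add1n expnSr mulnA.
rewrite !shiftE => eq_xy; have B0 : 0 < B by apply: leq_ltn_trans (xB ord0).
have eq0 : x ord0 = y ord0.
  by have := congr1 (modn^~ B) eq_xy; rewrite !modnMDl !modn_small.
move: eq_xy; rewrite eq0 => /eqP; rewrite eqn_add2r eqn_pmul2r // => /eqP eq_xy.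
move=> i; have [j ->|-> //] := unliftP ord0 i.
by apply: (IHn (x \o lift ord0) (y \o lift ord0)) => // k; rewrite /=.
Qed.

Section Evaluation.

Variables (G : zmodType) (n : nat) (a : 'I_n -> G) (B : nat).
Implicit Types m : {ffun 'I_n -> nat}.

Definition meval m : G := (\sum_i a i *+ m i)%R.
Definition mweight m : nat := \sum_i m i * B ^ i.

(** The word [f] stands for the product of its letters x_(f i); words index the monomials of degree
    [D] by a finite type. *)
Definition content (D : nat) (f : {ffun 'I_D -> 'I_n}) : {ffun 'I_n -> nat} :=
  [ffun j => \sum_i (f i == j)].

Lemma meval_mdivx i m : 0 < m i -> meval m = (a i + meval (mdivx i m))%R.
Proof.
move=> mi; rewrite /meval (bigD1 i) //= [in RHS](bigD1 i) //= ffunE eqxx subn1.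
rewrite addrA -mulrS prednK //; congr (_ + _)%R.
by apply: eq_bigr => j /negbTE ji; rewrite ffunE ji subn0.
Qed.

Lemma mweight_mdivx i m : 0 < m i -> mweight m = B ^ i + mweight (mdivx i m).
Proof.
move=> mi; rewrite /mweight (bigD1 i) //= [in RHS](bigD1 i) //= ffunE eqxx subn1.
rewrite addnA -mulSn prednK //; congr (_ + _).
by apply: eq_bigr => j /negbTE ji; rewrite ffunE ji subn0.
Qed.

Lemma leq_mdeg m i : m i <= mdeg m.
Proof. by rewrite /mdeg (bigD1 i) //= leq_addr. Qed.

Lemma mweight_inj m1 m2 :
  mdeg m1 < B -> mdeg m2 < B -> mweight m1 = mweight m2 -> m1 = m2.
Proof.
move=> lt1 lt2 eq12; apply/ffunP.
by apply: positional_inj eq12 => i; apply: leq_ltn_trans (leq_mdeg _ _) _.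
Qed.

Lemma meval_content D (f : {ffun 'I_D -> 'I_n}) :
  meval (content f) = (\sum_i a (f i))%R.
Proof.
rewrite /meval; under eq_bigr do rewrite ffunE -sumrMnr.
rewrite exchange_big; apply: eq_bigr => i _ /=.
rewrite (bigD1 (f i)) //= eqxx big1 ?addr0 // => j /negbTE.
by rewrite eq_sym => ->.
Qed.

Lemma mdeg_content D (f : {ffun 'I_D -> 'I_n}) : mdeg (content f) = D.
Proof.
rewrite /mdeg; under eq_bigr do rewrite ffunE.
rewrite exchange_big /= (eq_bigr (fun=> 1)) ?sum1_card ?card_ord // => i _.
rewrite (bigD1 (f i)) //= eqxx big1 // => j /negbTE.
by rewrite eq_sym => ->.
Qed.

(** Induction on the degree: divide by a variable that occurs and prepend it to a word of the
    quotient. *)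
Lemma content_surj m : exists f : {ffun 'I_(mdeg m) -> 'I_n}, m = content f.
Proof.
move: {2}(mdeg m) (erefl (mdeg m)) => D degm; rewrite degm.
elim: D m degm => [|D IHD] m degm.
  exists (ffun0 (card_ord 0)); apply/ffunP => i; rewrite ffunE big_ord0.
  by apply/eqP; rewrite -leqn0 -degm leq_mdeg.
have /existsP[i mi] : [exists i, 0 < m i].
  apply: contraPT degm; rewrite negb_exists => /forallP m0.
  by rewrite /mdeg big1 // => i _; apply/eqP; rewrite -leqn0 leqNgt m0.
have [f fE] := IHD (mdivx i m) (succn_inj (etrans (esym (mdeg_mdivx mi)) degm)).
exists [ffun k => oapp f i (unlift ord0 k)]; apply/ffunP => j.
rewrite ffunE big_ord_recl ffunE unlift_none /=.
have := congr1 (fun u : {ffun 'I_n -> nat} => u j) fE; rewrite !ffunE.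
under [X in _ = _ + X]eq_bigr do rewrite ffunE liftK /=.
move=> <-; rewrite (eq_sym i j); case: eqP => [->|_]; last by rewrite subn0.
by rewrite subnKC.
Qed.

Definition minimal_monomials (D : nat) : {fset {ffun 'I_n -> nat}} :=
  [fset content f | f : {ffun 'I_D -> 'I_n} in
     [pred f | [forall g : {ffun 'I_D -> 'I_n},
        (meval (content g) == meval (content f)) ==>
        (mweight (content f) <= mweight (content g))]]].

Lemma minimal_monomialsP D m : reflect
  (mdeg m = D /\ forall m', mdeg m' = D -> meval m' = meval m ->
     mweight m <= mweight m')
  (m \in minimal_monomials D).
Proof.
apply: (iffP (imfsetP _ _ _ _)) => [[f /= /forallP minf ->]|[]].
  split=> [|m' degm' evm']; first exact: mdeg_content.
  case: (content_surj m'); rewrite degm' => g gE; rewrite gE.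
  by apply: (implyP (minf g)); rewrite -gE evm'.
move=> <- minm; have [f fE] := content_surj m; exists f => //=.
apply/forallP => g; apply/implyP => /eqP evg.
by rewrite -fE minm ?mdeg_content // evg -fE.
Qed.

(** A competitor of [mdivx i m], once multiplied by x_i, competes with [m], and the common [B ^ i]
    cancels from the weights. *)
Lemma covers_shadow_minimal D :
  covers_shadow (minimal_monomials D) (minimal_monomials D.+1).
Proof.
move=> m i /minimal_monomialsP[degm minm] mi; apply/minimal_monomialsP.
split=> [|m' degm' evm']; first by apply: succn_inj; rewrite -mdeg_mdivx.
pose u : {ffun 'I_n -> nat} := [ffun j => m' j + (j == i)].
have uK : mdivx i u = m' by apply/ffunP => j; rewrite !ffunE addnK.
have ui : 0 < u i by rewrite ffunE eqxx addn1.
have := minm u; rewrite (mdeg_mdivx ui) (meval_mdivx ui) (meval_mdivx mi) uK degm' evm'.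
by rewrite (mweight_mdivx ui) (mweight_mdivx mi) uK leq_add2l; apply.
Qed.

(** Minimality in both directions gives equal weights, and weights separate monomials of degree
    below [B]. *)
Lemma meval_minimal_inj D :
  D < B -> {in minimal_monomials D &, injective meval}.
Proof.
move=> DB m1 m2 /minimal_monomialsP[deg1 min1] /minimal_monomialsP[deg2 min2] ev12.
apply: mweight_inj; rewrite ?deg1 ?deg2 //.
by apply/eqP; rewrite eqn_leq min1 ?min2.
Qed.

Lemma meval_minimal D (A : {fset G}) : A =i codom a ->
  [fset meval m | m in minimal_monomials D] = sumset D A.
Proof.
move=> Aa; apply/fsetP => z; apply/imfsetP/sumsetP => [[m /=]|[x xA ->]].
  case/minimal_monomialsP=> <- _ ->; have [f fE] := content_surj m.
  exists (a \o f); last by rewrite [in LHS]fE meval_content.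
  by move=> i; rewrite Aa; apply: codom_f.
have /fin_all_exists[f0 f0E] i : exists j, x i = a j.
  by apply/codomP; rewrite -Aa.
pose f := [ffun i => f0 i]; have fE : meval (content f) = (\sum_i x i)%R.
  by rewrite meval_content; apply: eq_bigr => i _; rewrite ffunE f0E.
pose P (g : {ffun 'I_D -> 'I_n}) := meval (content g) == (\sum_i x i)%R.
have Pf : P f by apply/eqP.
have [g /eqP gE ming] := arg_minnP (fun g => mweight (content g)) Pf.
exists (content g) => //=; apply/minimal_monomialsP.
split=> [|m' degm' evm']; first exact: mdeg_content.
move: (content_surj m'); rewrite degm' => -[g' g'E]; rewrite g'E.
by apply: ming; rewrite /P -g'E evm' gE.
Qed.

Lemma card_minimal_monomials D (A : {fset G}) : A =i codom a -> D < B ->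
  #|` minimal_monomials D| = #|` sumset D A|.
Proof.
move=> Aa DB; rewrite -(meval_minimal D Aa) [RHS]card_in_imfset //=.
by move=> m1 m2; apply: meval_minimal_inj.
Qed.

End Evaluation.

(** * Application of Macaulay's bound to sumsets *)

Theorem theorem4p3 (G : zmodType) (A : {fset G}) (h : nat)
    (A_neq0 : A <> fset0) (h_ge1 : 1 <= h) :
  #|` sumset h.+1 A| <= binom_upper #|` sumset h A| h.
Proof.
case: h h_ge1 => // h _.
pose a (i : 'I_#|` A|) : G := nth 0%R A i.
have Aa : A =i codom a.
  move=> z; apply/idP/codomP => [zA|[i ->]]; last exact: mem_nth.
  have iA : index z A < #|` A| by rewrite index_mem.
  by exists (Ordinal iA); rewrite /a nth_index.
have /is_binom_repP[_ repE] := binom_repP #|` sumset h.+1 A| (ltn0Sn h).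
(* [inord] extends the representation to all naturals, the form [macaulay_growth] takes. *)
pose c (j : nat) : nat := binom_rep #|` sumset h.+1 A| h.+1 (inord j).
have cE (j : 'I_h.+1) : binom_rep #|` sumset h.+1 A| h.+1 j = c j by rewrite /c inord_val.
(* After the case analysis the degrees are [h.+1] and [h.+2]; the base [h.+3] exceeds both. *)
rewrite -(@card_minimal_monomials _ _ a h.+3 h.+2 A) // /binom_upper.
under eq_bigr do rewrite cE.
apply: (macaulay_growth (J := setT) _ (@covers_shadow_minimal _ _ a h.+3 h.+1)).
  by move=> m /minimal_monomialsP[degm _]; split=> // i; rewrite inE.
rewrite (card_minimal_monomials Aa) // [X in X <= _]repE.
by under eq_bigr do rewrite cE.
Qed.
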